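(* Let $\Omega$ be a compact Hausdorff space with a regular Borel measure $\mu$ whose support is $\Omega$, and let $K\in C(\Omega\times\Omega)$ be a symmetric positive definite kernel with (infinitely many) positive eigenvalues $\{\lambda_n:n\in\mathbb{N}\}$ and continuous eigenfunctions $\{e_n:n\in\mathbb{N}\}$ satisfying $$\sum_{n\in\mathbb{N}}\lambda_n^{1/2}|e_n(x)|<\infty\quad\text{for all }x\in\Omega.$$ Then $\mathcal{B}_K^1(\Omega)$ is a right-sided reproducing kernel Banach space with the right-sided reproducing kernel $K$, and for every $1<p\le\infty$ the space $\mathcal{B}_K^p(\Omega)$ is a two-sided reproducing kernel Banach space with the two-sided reproducing kernel $K$.
   Context: A kernel $K:\Omega\times\Omega\to\mathbb{R}$ is positive definite if $\sum_{j,k=1}^Nc_jc_kK(x_j,x_k)\ge0$ for all $N$, all pairwise distinct $x_1,\dots,x_N\in\Omega$ and all $c\in\mathbb{R}^N$. The eigenvalues $\lambda_n>0$ and eigenfunctions $e_n\in C(\Omega)$ are those of the integral operator $(I_K\zeta)(y)=\int_\Omega K(x,y)\zeta(x)\,\mu(dx)$, i.e. $I_Ke_n=\lambda_ne_n$; $\{e_n\}$ is chosen orthonormal in $L_2(\Omega,\mu)$ and $K(x,y)=\sum_n\lambda_ne_n(x)e_n(y)$ absolutely and uniformly (Mercer's theorem). It is assumed that there are infinitely many of them, and the choice of eigenfunctions is fixed. For $1\le p<\infty$: $\mathcal{B}_K^p(\Omega):=\{f=\sum_na_n\lambda_n^{1/2}e_n:(a_n)\in\ell_p\}$ with norm $(\sum_n|a_n|^p)^{1/p}$.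 For $p=\infty$: $\mathcal{B}_K^\infty(\Omega):=\{f=\sum_na_n\lambda_n^{1/2}e_n:(a_n)\in c_0\}$ with norm $\sup_n|a_n|$, where $c_0$ is the space of real sequences tending to $0$. Reproducing kernel Banach spaces (here with both domains equal to $\Omega$): $L_0(\Omega)$ denotes the real-valued measurable functions on $\Omega$ (genuine functions). Let $\mathcal{B}$ be a Banach space consisting of functions in $L_0(\Omega)$ whose continuous dual $\mathcal{B}'$ is isometrically isomorphic to a normed space $\mathcal{F}$ consisting of functions in $L_0(\Omega)$, identified with $\mathcal{B}'$; write $\langle f,G\rangle_{\mathcal{B}}:=G(f)$. $\mathcal{B}$ is right-sided with right-sided reproducing kernel $K$ if (i) $K(x,\cdot)\in\mathcal{F}\cong\mathcal{B}'$ for each $x\in\Omega$ and (ii) $\langle f,K(x,\cdot)\rangle_{\mathcal{B}}=f(x)$ for all $f\in\mathcal{B}$, $x\in\Omega$. It is two-sided with two-sided reproducing kernel $K$ if in addition (iii) $K(\cdot,y)\in\mathcal{B}$ for each $y\in\Omega$ and (iv) $\langle K(\cdot,y),g\rangle_{\mathcal{B}}=g(y)$ for all $g\in\mathcal{F}$, $y\in\Omega$. *)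

(* Defs.v *)
From HB Require Import structures.
From mathcomp Require Import all_boot all_order all_algebra.
From mathcomp Require Import all_classical all_reals all_analysis.

Set Implicit Arguments.
Unset Strict Implicit.
Unset Printing Implicit Defensive.

Import Order.TTheory GRing.Theory Num.Theory.
Import numFieldNormedType.Exports.

Local Open Scope classical_set_scope.
Local Open Scope ring_scope.

(* [T] with its Borel sigma-algebra. Measurable structures are pointed in the
   library, hence the [ptopologicalType]s below. *)
Notation borelType T := (g_sigma_algebraType (@open T)).

Section Measure.
Context {R : realType} {T : ptopologicalType}.
Variable mu : {measure set (borelType T) -> \bar R}.

Definition regular_borel : Prop :=
  [/\ forall C : set T, compact C -> (mu C < +oo)%E,
      forall A : set (borelType T), measurable A ->
        mu A = ereal_inf [set mu U | U in [set U : set T | open U /\ A `<=` U]]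
    & forall A : set (borelType T), measurable A ->
        mu A = ereal_sup [set mu C | C in [set C : set T | compact C /\ C `<=` A]]].

Definition msupport : set T :=
  [set x | forall U : set T, open U -> U x -> (0 < mu U)%E].

End Measure.

Section Kernel.
Context {R : realType} {T : ptopologicalType}.

Definition positive_definite (K : T -> T -> R) : Prop :=
  forall (N : nat) (x : 'I_N -> T) (c : 'I_N -> R), injective x ->
    0 <= \sum_(j < N) \sum_(k < N) c j * c k * K (x j) (x k).

Definition integral_op (mu : {measure set (borelType T) -> \bar R})
    (K : T -> T -> R) (z : T -> R) (y : T) : R :=
  \int[mu]_x (K x y * z x).

(* [lambda], [e] enumerate, with multiplicity, the positive eigenvalues of the
   integral operator of [K] and an orthonormal family of continuous
   eigenfunctions, with the expansion of [K] given by Mercer's theorem. *)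
Record mercer_system (mu : {measure set (borelType T) -> \bar R})
    (K : T -> T -> R) (lambda : nat -> R) (e : nat -> T -> R) : Prop := {
  ms_gt0 : forall n, 0 < lambda n;
  ms_continuous : forall n, continuous (e n);
  ms_eigen : forall n y, integral_op mu K (e n) y = lambda n * e n y;
  ms_orthonormal : forall m n, \int[mu]_x (e m x * e n x) = (m == n)%:R;
  ms_complete : forall (nu : R) (phi : T -> R), 0 < nu -> continuous phi ->
    (forall y, integral_op mu K phi y = nu * phi y) ->
    exists (N : nat) (c : nat -> R), forall y,
      phi y = \sum_(0 <= n < N | lambda n == nu) c n * e n y;
  ms_expansion_abs : forall x y,
    cvgn (series (fun n => `|lambda n * e n x * e n y|));
  ms_expansion_unif :
    {uniform, (fun N (z : T * T) =>
                 \sum_(0 <= n < N) lambda n * e n z.1 * e n z.2) @ \oo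
              --> (fun z : T * T => K z.1 z.2)} }.

End Kernel.

Section SequenceSpaces.
Context {R : realType}.

(* The sequence space attached to [p] : l_p when [p] is finite, and c_0, the
   null sequences, when [p] is +oo. *)
Definition in_lp (p : \bar R) (a : nat -> R) : Prop :=
  match p with
  | r%:E => cvgn (series (fun n => `|a n| `^ r))
  | +oo%E => a @ \oo --> (0 : R)
  | -oo%E => False
  end.

Definition lp_norm (p : \bar R) (a : nat -> R) : R :=
  match p with
  | r%:E => (limn (series (fun n => `|a n| `^ r))) `^ r^-1
  | +oo%E => sup (range (fun n => `|a n|))
  | -oo%E => 0
  end.

End SequenceSpaces.

Section FunctionSpaces.
Context {R : realType} {T : ptopologicalType}.

(* A normed space of functions on [T] is a normed module [V] with an injective
   linear map [ev] to genuine functions; [v] stands for the function [ev v]. *)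
Definition function_space (V : normedModType R) (ev : V -> T -> R) : Prop :=
  [/\ forall x, scalar (ev^~ x),
      injective ev
    & forall v, measurable_fun [set: borelType T] (ev v : borelType T -> R)].

Definition continuous_dual (V : normedModType R) : set (V -> R) :=
  [set phi : V -> R | scalar phi /\ continuous phi].

Definition dual_norm (V : normedModType R) (phi : V -> R) : R :=
  sup [set `|phi v| | v in [set v : V | `|v| <= 1]].

(* [g |-> pair^~ g] is an isometric isomorphism of [W] onto the dual of [V];
   isometry makes it injective. *)
Definition dual_pairing (V W : normedModType R) (pair : V -> W -> R) : Prop :=
  [/\ forall g, continuous_dual (pair^~ g),
      forall v, scalar (pair v),
      forall g, `|g| = dual_norm (pair^~ g)
    & forall phi, continuous_dual phi -> exists g, phi = pair^~ g].

(* [K x] is the function K(x, .) and [K^~ y] the function K(., y). *)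
Definition right_reproducing (V W : normedModType R) (evV : V -> T -> R)
    (evW : W -> T -> R) (pair : V -> W -> R) (K : T -> T -> R) : Prop :=
  forall x, exists2 g : W, evW g = K x & forall f, pair f g = evV f x.

Definition left_reproducing (V W : normedModType R) (evV : V -> T -> R)
    (evW : W -> T -> R) (pair : V -> W -> R) (K : T -> T -> R) : Prop :=
  forall y, exists2 f : V, evV f = K^~ y & forall g, pair f g = evW g y.

Definition right_sided_RKBS (V : completeNormedModType R) (evV : V -> T -> R)
    (K : T -> T -> R) : Prop :=
  function_space evV /\
  exists (W : normedModType R) (evW : W -> T -> R) (pair : V -> W -> R),
    [/\ function_space evW, dual_pairing pair
      & right_reproducing evV evW pair K].

Definition two_sided_RKBS (V : completeNormedModType R) (evV : V -> T -> R)
    (K : T -> T -> R) : Prop :=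
  function_space evV /\
  exists (W : normedModType R) (evW : W -> T -> R) (pair : V -> W -> R),
    [/\ function_space evW, dual_pairing pair,
        right_reproducing evV evW pair K
      & left_reproducing evV evW pair K].

Variables (lambda : nat -> R) (e : nat -> T -> R).

(* f = \sum_n a_n lambda_n^(1/2) e_n, pointwise *)
Definition expands (a : nat -> R) (f : T -> R) : Prop :=
  forall x, series (fun n => a n * Num.sqrt (lambda n) * e n x) @ \oo --> f x.

(* [V], through [ev], is the space B_K^p: its functions are those with
   coefficients in [in_lp p], and its norm is the norm of the coefficients. *)
Definition is_BK (p : \bar R) (V : normedModType R) (ev : V -> T -> R) : Prop :=
  range ev = [set f | exists2 a, in_lp p a & expands a f] /\
  forall v a, in_lp p a -> expands a (ev v) -> `|v| = lp_norm p a.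

End FunctionSpaces.

(* Main.v *)
(* Put f_n = lambda_n^(1/2) e_n. For B_K^p take the sequence space l_p (c_0 when
   p = +oo) with a standing for \sum_n a_n f_n, and for F its whole continuous
   dual, G standing for the function x |-> G ((f_n x)_n); this makes sense
   because (f_n x)_n is summable. The reproducing identities are then the
   Mercer expansion of K. Finite sequences are dense, so G is determined by the
   bounded sequence (G (delta_n))_n, and everything reduces to showing that
   \sum_n a_n f_n = 0 forces a = 0 for bounded a. The trace formula gives
   \sum_n lambda_n < +oo, so c_n = a_n lambda_n^(1/2) is square summable, and
   Fatou's lemma applied to the tails of \sum_n c_n e_n yields
   \sum_(n < N) c_n^2 <= \sum_(n >= N) c_n^2 for all N, hence c = 0. *)
Require Import Defs.
From HB Require Import structures.
From mathcomp Require Import all_boot all_order all_algebra.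
From mathcomp Require Import all_classical all_reals all_analysis.
From mathcomp Require Import measurable_realfun ring.

Set Implicit Arguments.
Unset Strict Implicit.
Unset Printing Implicit Defensive.

Import Order.TTheory GRing.Theory Num.Theory.
Import numFieldNormedType.Exports.

Local Open Scope classical_set_scope.
Local Open Scope ring_scope.

(** * Dual of a normed module *)

Section DualSpace.
Context {R : realType} (V : normedModType R).

Definition dual_pred : pred (V -> R) := fun phi => `[< continuous_dual phi >].

Lemma dual_predP (phi : V -> R) :
  reflect (continuous_dual phi) (phi \in dual_pred).
Proof. exact: asboolP. Qed.

(** Bundles a functional known only through the predicate [scalar], so that the theory of linear
    maps ([linear0], [linear_sum], boundedness versus continuity) applies to it. *)
Lemma scalar_is_linear (phi : V -> R) : scalar phi ->
  exists f : {linear V -> R^o}, f = phi :> (V -> R).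
Proof.
move=> lphi.
pose mx := GRing.isLinear.Build R V R^o *:%R phi lphi.
pose f : {linear V -> R^o} := HB.pack phi mx.
by exists f.
Qed.

Lemma continuous_dualP (phi : V -> R) : scalar phi ->
  continuous phi <-> exists C, forall v, `|phi v| <= C * `|v|.
Proof.
move=> /scalar_is_linear[f <-]; split.
- move=> cf; have /linear_boundedP := (linear_bounded_continuous f).2 cf.
  by move=> /pinfty_ex_gt0[C _ fC]; exists C.
- move=> [C fC]; apply/(linear_bounded_continuous f).
  apply/linear_boundedP; near=> r => x.
  by apply: le_trans (fC x) _; apply: ler_wpM2r.
Unshelve. all: by end_near. Qed.

Lemma dual_submod_closed : submod_closed dual_pred.
Proof.
split=> [|c f g /dual_predP[lf cf] /dual_predP[lg cg]]; apply/dual_predP.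
  split; first by move=> a u v; rewrite /= mulr0 addr0.
  exact: cst_continuous.
split; last first.
  by move=> v; apply: cvgD; [apply: cvgM; [exact: cvg_cst|exact: cf]|exact: cg].
move=> a u v.
have E w : (c *: f + g) w = c * f w + g w by [].
by rewrite !E lf lg !mulrDr !mulrA addrACA (mulrC c a).
Qed.

HB.instance Definition _ :=
  GRing.isSubmodClosed.Build R (V -> R) dual_pred dual_submod_closed.

Record dual_space := DualSpace { dual_fun :> V -> R; _ : dual_fun \in dual_pred }.

HB.instance Definition _ := [isSub for dual_fun].
HB.instance Definition _ := [Choice of dual_space by <:].
HB.instance Definition _ := [SubChoice_isSubLmodule of dual_space by <:].

Lemma dual_space_continuous (g : dual_space) : continuous_dual g.
Proof. by case: g => g /= /dual_predP. Qed.

Lemma dual_norm_has_sup (phi : V -> R) : continuous_dual phi ->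
  has_sup [set `|phi v| | v in [set v : V | `|v| <= 1]].
Proof.
move=> [lphi /(continuous_dualP lphi)[C phiC]]; split.
  by exists `|phi 0|, 0 => //=; rewrite normr0.
exists `|C| => _ [v /= v1 <-]; apply: le_trans (phiC v) _.
apply: le_trans (ler_wpM2r _ (ler_norm C)) _ => //.
by rewrite ler_piMr.
Qed.

Lemma le_dual_norm (phi : V -> R) (v : V) : continuous_dual phi ->
  `|phi v| <= dual_norm phi * `|v|.
Proof.
move=> dphi; have [-> |v0] := eqVneq v 0.
  have [f <-] := scalar_is_linear dphi.1.
  by rewrite linear0 !normr0 mulr0.
have nv0 : 0 < `|v| by rewrite normr_gt0.
rewrite -ler_pdivrMr//.
(* Homogeneity moves the factor inside: the quotient is the value at the normalized vector, one of
   the competitors in the supremum. *)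
have -> : `|phi v| / `|v| = `|phi (`|v|^-1 *: v)|.
  have [f <-] := scalar_is_linear dphi.1.
  by rewrite linearZ/= normrM gtr0_norm ?invr_gt0// mulrC.
apply: ub_le_sup; first exact: (dual_norm_has_sup dphi).2.
exists (`|v|^-1 *: v) => //=.
by rewrite normrZ gtr0_norm ?invr_gt0// mulVf ?gt_eqF.
Qed.

Lemma dual_norm_le (phi : V -> R) (C : R) : continuous_dual phi ->
  (forall v, `|v| <= 1 -> `|phi v| <= C) -> dual_norm phi <= C.
Proof.
move=> dphi phiC; apply: ge_sup; first exact: (dual_norm_has_sup dphi).1.
by move=> _ [v /= v1 <-]; exact: phiC.
Qed.

Lemma dual_norm_ub (phi : V -> R) (v : V) : continuous_dual phi -> `|v| <= 1 ->
  `|phi v| <= dual_norm phi.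
Proof.
move=> dphi v1; apply: ub_le_sup; first exact: (dual_norm_has_sup dphi).2.
by exists v.
Qed.

Lemma dual_norm_triangle (f g : dual_space) :
  dual_norm (f + g) <= dual_norm f + dual_norm g.
Proof.
apply: dual_norm_le => [|v v1]; first exact: dual_space_continuous.
apply: le_trans (ler_normD _ _) _.
by apply: lerD; apply: dual_norm_ub => //; exact: dual_space_continuous.
Qed.

Lemma dual_normZ_le (c : R) (g : dual_space) :
  dual_norm (c *: g) <= `|c| * dual_norm g.
Proof.
apply: dual_norm_le => [|v v1]; first exact: dual_space_continuous.
have -> : (c *: g) v = c * g v by [].
rewrite normrM ler_wpM2l//; apply: dual_norm_ub => //.
exact: dual_space_continuous.
Qed.

Lemma dual_norm_ge0 (g : dual_space) : 0 <= dual_norm g.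
Proof.
apply: le_trans (normr_ge0 (g 0)) _.
by apply: dual_norm_ub; [exact: dual_space_continuous|rewrite normr0].
Qed.

Lemma dual_normZ (c : R) (g : dual_space) :
  dual_norm (c *: g) = `|c| * dual_norm g.
Proof.
apply: le_anti; rewrite dual_normZ_le andTb.
have [->|c0] := eqVneq c 0.
  by rewrite normr0 mul0r; exact: dual_norm_ge0.
(* The reverse inequality is the one already proved, applied to the scalar [c^-1] and the functional
   [c *: g]. *)
have := dual_normZ_le c^-1 (c *: g); rewrite scalerA mulVf// scale1r normfV.
by rewrite ler_pdivlMl// normr_gt0.
Qed.

Lemma dual_norm_eq0 (g : dual_space) : dual_norm g = 0 -> g = 0.
Proof.
move=> g0; apply/val_inj/funext => v /=; apply/eqP; rewrite -normr_le0.
by have := le_dual_norm v (dual_space_continuous g); rewrite g0 mul0r.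
Qed.

HB.instance Definition _ := Lmodule_isNormed.Build R dual_space
  dual_norm_triangle dual_normZ dual_norm_eq0.

(** The norm of [dual_space] is [dual_norm] by construction, so only continuity and surjectivity
    have content. *)
Lemma dual_pairing_dual_space :
  dual_pairing (fun (v : V) (g : dual_space) => g v).
Proof.
split=> //; first exact: dual_space_continuous.
by move=> phi /dual_predP dphi; exists (DualSpace dphi).
Qed.

End DualSpace.

(** * Banach spaces of sequences *)

(* The norms of the initial sections of a sequence, for a norm on sequences
   that is monotone in the absolute values of the entries. *)
Record section_norm (R : realType) := SectionNorm {
  sec :> nat -> (nat -> R) -> R;
  sec0 : forall a, sec 0 a = 0;
  secS_ge : forall n a, sec n a <= sec n.+1 a;
  secS_le : forall n a, sec n.+1 a <= sec n a + `|a n|;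
  sec_coord : forall n a, `|a n| <= sec n.+1 a;
  sec_solid : forall n a b, (forall k, (k < n)%N -> `|a k| <= `|b k|) ->
    sec n a <= sec n b;
  secD : forall n a b, sec n (fun k => a k + b k) <= sec n a + sec n b;
  secZ : forall n c a, sec n (fun k => c * a k) = `|c| * sec n a
}.

(** The head is zeroed rather than shifted away, so that a tail can be compared with the sequence
    entry by entry. *)
Definition seq_tail (R : realType) (M : nat) (a : nat -> R) : nat -> R :=
  fun n => if (n < M)%N then 0 else a n.

Definition seq_delta (R : realType) (m : nat) : nat -> R := fun n => (n == m)%:R.

(** Adding the first [M] terms back to the truncated tail gives the partial sum of length
    [maxn n M], which is at most the limit. *)
Lemma series_seq_tail_le (R : realType) (u : nat -> R) M n :
  (forall k, 0 <= u k) -> cvgn (series u) ->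
  series (seq_tail M u) n <= limn (series u) - series u M.
Proof.
move=> u0 cu; rewrite lerBrDr.
have nd : nondecreasing_seq (series u) by apply: nondecreasing_series => k _ _.
apply: le_trans (nondecreasing_cvgn_le nd cu (maxn n M)).
elim: n => [|n IHn]; first by rewrite {1}seriesEnat/= big_geq// add0r max0n.
rewrite seriesSr {2}/seq_tail; have [nM|Mn] := ltnP n M.
  by rewrite addr0 (maxn_idPr nM); rewrite (maxn_idPr (ltnW nM)) in IHn.
rewrite (maxn_idPl Mn) in IHn; rewrite (maxn_idPl (leqW Mn)) seriesSr.
by rewrite addrAC lerD2r.
Qed.

Lemma series_seq_tail_small (R : realType) (u : nat -> R) (e : R) :
  (forall k, 0 <= u k) -> cvgn (series u) -> 0 < e ->
  exists M, forall n, series (seq_tail M u) n <= e.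
Proof.
move=> u0 cu e0; have /cvgrPdist_le/(_ e e0)[M _ /(_ M (leqnn M)) uM] := cu.
exists M => n; apply: le_trans (series_seq_tail_le M n u0 cu) _.
exact: le_trans (ler_norm _) uM.
Qed.

(** * Sequences with vanishing tails as a normed space *)

Section SectionNormTheory.
Context {R : realType} (s : section_norm R).
Implicit Types (a b : nat -> R) (m n M N : nat).

Lemma sec_mono a : {homo s ^~ a : m n / (m <= n)%N >-> m <= n}.
Proof.
by apply: homo_leq => //; [exact: le_trans|move=> n; exact: secS_ge].
Qed.

Lemma sec_ge0 n a : 0 <= s n a.
Proof. by rewrite -(sec0 s a); exact: sec_mono. Qed.

Lemma sec_eq0 n a : (forall k, (k < n)%N -> a k = 0) -> s n a = 0.
Proof.
move=> a0; apply: le_anti; rewrite sec_ge0 andbT.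
(* Solidity compares [a] with its zero multiple, whose section norm vanishes by homogeneity. *)
apply: le_trans (_ : s n (fun k => 0 * a k) <= 0); last first.
  by rewrite secZ normr0 mul0r.
by apply: sec_solid => k /a0 ->; rewrite mul0r.
Qed.

Lemma sec_le_series n a : s n a <= series (fun k => `|a k|) n.
Proof.
elim: n => [|n IHn]; first by rewrite sec0 seriesEnat/= big_geq.
by rewrite seriesSr (le_trans (secS_le _ _ _))// lerD2r.
Qed.

Lemma sec_seq_tail n M a : s n (seq_tail M a) <= s n a.
Proof. by apply: sec_solid => k _; rewrite /seq_tail; case: ifP; rewrite ?normr0. Qed.

Lemma sec_seq_tail_anti n M N a : (M <= N)%N ->
  s n (seq_tail N a) <= s n (seq_tail M a).
Proof.
move=> MN; apply: sec_solid => k _; rewrite /seq_tail.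
by case: ltnP => [_|Nk]; rewrite ?normr0// ltnNge (leq_trans MN Nk).
Qed.

Lemma sec_split n M a : s n a <= s M a + s n (seq_tail M a).
Proof.
elim: n => [|n IHn]; first by rewrite sec0 addr_ge0 ?sec_ge0.
have [nM|Mn] := ltnP n M.
  by rewrite (le_trans (sec_mono a nM))// lerDl sec_ge0.
(* [h] is the head of [a], and its section norms stop growing at index [M]; the bound is then the
   triangle inequality for head plus tail. *)
pose h k := if (k < M)%N then a k else 0.
have hle m : s m h <= s M a.
  elim: m => [|m IHm]; first by rewrite sec0 sec_ge0.
  have [mM|Mm] := ltnP m M.
    apply: le_trans (sec_mono a mM); apply: sec_solid => k _.
    by rewrite /h; case: ifP; rewrite ?normr0.
  apply: le_trans (secS_le _ _ _) _.
  by rewrite /h ltnNge Mm/= normr0 addr0.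
have -> : a = (fun k => h k + seq_tail M a k).
  by apply/funext => k; rewrite /h /seq_tail; case: ifP; rewrite ?addr0 ?add0r.
apply: le_trans (secD _ _ _ _) _; rewrite lerD//.
  apply: le_trans (hle _) _; apply: sec_solid => k kM.
  by rewrite /h /seq_tail kM addr0.
by apply: sec_solid => k _; rewrite /h /seq_tail; case: ifP; rewrite ?addr0 ?add0r.
Qed.

(* Membership in the closure of the finite sequences: this is l_p for the
   l_p norms and c_0 for the sup norm. *)
Definition null_tails a : Prop :=
  forall e, 0 < e -> exists M, forall N, s N (seq_tail M a) <= e.

Definition null_tails_pred : pred (nat -> R) := fun a => `[< null_tails a >].

Lemma null_tailsP a : reflect (null_tails a) (a \in null_tails_pred).
Proof. exact: asboolP. Qed.

Lemma null_tails_lin (c : R) a b : null_tails a -> null_tails b ->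
  null_tails (fun k => c * a k + b k).
Proof.
move=> nta ntb e e0; have e2 : 0 < e / 2 by rewrite divr_gt0.
have c1 : 0 < `|c| + 1 by rewrite ltr_wpDl.
have [Ma aM] := nta _ (divr_gt0 e2 c1).
have [Mb bM] := ntb _ e2.
exists (maxn Ma Mb) => N.
have -> : seq_tail (maxn Ma Mb) (fun k => c * a k + b k) =
    (fun k => c * seq_tail (maxn Ma Mb) a k + seq_tail (maxn Ma Mb) b k).
  apply/funext => k; rewrite /seq_tail; case: ifP => // _.
  by rewrite mulr0 addr0.
apply: le_trans (secD _ _ _ _) _; rewrite secZ (splitr e) lerD//; last first.
  exact: le_trans (sec_seq_tail_anti _ _ (leq_maxr _ _)) (bM N).
have := le_trans (sec_seq_tail_anti N a (leq_maxl Ma Mb)) (aM N).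
rewrite ler_pdivlMr//; apply: le_trans.
by rewrite mulrC ler_wpM2l ?sec_ge0// lerDl.
Qed.

Lemma null_tails_submod_closed : submod_closed null_tails_pred.
Proof.
split=> [|c a b /null_tailsP nta /null_tailsP ntb]; apply/null_tailsP.
  by move=> e e0; exists 0%N => N; rewrite sec_eq0 ?ltW// => k _;
    rewrite /seq_tail if_same.
exact: (null_tails_lin c nta ntb).
Qed.

HB.instance Definition _ := GRing.isSubmodClosed.Build R (nat -> R)
  null_tails_pred null_tails_submod_closed.

Record seq_space := SeqSpace { coords :> nat -> R; _ : coords \in null_tails_pred }.

HB.instance Definition _ := [isSub for coords].
HB.instance Definition _ := [Choice of seq_space by <:].
HB.instance Definition _ := [SubChoice_isSubLmodule of seq_space by <:].

Lemma seq_space_null_tails (v : seq_space) : null_tails v.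
Proof. by case: v => v /= /null_tailsP. Qed.

Definition seq_norm a : R := sup (range (s ^~ a)).

(** Splitting at an index where the tail has norm at most 1 bounds every section by [s M a + 1]. *)
Lemma seq_norm_has_sup a : null_tails a -> has_sup (range (s ^~ a)).
Proof.
move=> /(_ 1 ltr01)[M aM]; split; first by exists (s 0%N a), 0%N.
exists (s M a + 1) => _ [N _ <-].
by apply: le_trans (sec_split _ M _) _; rewrite lerD2l.
Qed.

Lemma le_seq_norm a N : null_tails a -> s N a <= seq_norm a.
Proof.
by move=> nta; apply: ub_le_sup; [exact: (seq_norm_has_sup nta).2|exists N].
Qed.

Lemma seq_norm_le a C : (forall N, s N a <= C) -> seq_norm a <= C.
Proof.
move=> aC; apply: ge_sup; first by exists (s 0%N a), 0%N.
by move=> _ [N _ <-].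
Qed.

Lemma coord_le_norm a n : null_tails a -> `|a n| <= seq_norm a.
Proof. by move=> nta; exact: le_trans (sec_coord _ _ _) (le_seq_norm _ nta). Qed.

Lemma seq_norm_ge0 a : null_tails a -> 0 <= seq_norm a.
Proof. by move=> nta; exact: le_trans (normr_ge0 _) (coord_le_norm 0%N nta). Qed.

Lemma seq_norm_triangle (u v : seq_space) :
  seq_norm (u + v) <= seq_norm u + seq_norm v.
Proof.
apply: seq_norm_le => N; apply: le_trans (secD _ _ _ _) _.
by apply: lerD; apply: le_seq_norm; exact: seq_space_null_tails.
Qed.

Lemma seq_normZ_le (c : R) (v : seq_space) :
  seq_norm (c *: v) <= `|c| * seq_norm v.
Proof.
apply: seq_norm_le => N.
rewrite [leLHS]secZ ler_wpM2l//; apply: le_seq_norm.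
exact: seq_space_null_tails.
Qed.

Lemma seq_normZ (c : R) (v : seq_space) :
  seq_norm (c *: v) = `|c| * seq_norm v.
Proof.
apply: le_anti; rewrite seq_normZ_le andTb.
have [->|c0] := eqVneq c 0.
  by rewrite normr0 mul0r; apply/seq_norm_ge0/seq_space_null_tails.
have := seq_normZ_le c^-1 (c *: v); rewrite scalerA mulVf// scale1r normfV.
by rewrite ler_pdivlMl// normr_gt0.
Qed.

Lemma seq_norm_eq0 (v : seq_space) : seq_norm v = 0 -> v = 0.
Proof.
move=> v0; apply/val_inj/funext => n /=; apply/eqP; rewrite -normr_le0.
by have := coord_le_norm n (seq_space_null_tails v); rewrite v0.
Qed.

HB.instance Definition _ := Lmodule_isNormed.Build R seq_space
  seq_norm_triangle seq_normZ seq_norm_eq0.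

Lemma seq_spaceE (v : seq_space) : `|v| = seq_norm v.
Proof. by []. Qed.

Lemma seq_space_le_norm (v : seq_space) n : s n v <= `|v|.
Proof. by apply: le_seq_norm; exact: seq_space_null_tails. Qed.

Lemma seq_space_coord (v : seq_space) n : `|v n| <= `|v|.
Proof. by apply: coord_le_norm; exact: seq_space_null_tails. Qed.

End SectionNormTheory.

(** * Completeness, unit sequences, and the embedding of summable sequences *)

Section SeqSpaceComplete.
Context {R : realType} (s : section_norm R).
Local Notation V := (seq_space s).

(** The factor [n] is crude but enough to turn coordinatewise convergence into convergence of a
    section of fixed length. *)
Lemma sec_le_coords n (a : nat -> R) (d : R) :
  (forall k, (k < n)%N -> `|a k| <= d) -> s n a <= d *+ n.
Proof.
move=> ad; apply: le_trans (sec_le_series _ _ _) _.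
rewrite seriesEord/= -[n in leRHS]card_ord -sumr_const.
by apply: ler_sum => i _; exact: ad.
Qed.

Lemma sec_tailB n M (a b : nat -> R) :
  s n (seq_tail M a) <= s n (fun k => a k - b k) + s n (seq_tail M b).
Proof.
apply: le_trans (_ : s n (fun k => seq_tail M (fun k => a k - b k) k +
    seq_tail M b k) <= _).
  by apply: sec_solid => k _; rewrite /seq_tail; case: ifP; rewrite ?addr0 ?subrK.
apply: le_trans (secD _ _ _ _) _; rewrite lerD2r; exact: sec_seq_tail.
Qed.

(** The limit is taken coordinatewise. A bound on sections of fixed length survives this limit,
    hence holds for all lengths at once, and the small tails of a nearby element pass to the
    limit. *)
Lemma seq_space_complete (F : set_system V) :
  ProperFilter F -> cauchy F -> cvg F.
Proof.
move=> FF /cauchyP Fc.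
(* Coordinates are 1-Lipschitz, so they send the Cauchy filter to Cauchy filters on the reals. *)
have coord_cvg k : exists l : R, (fun v : V => v k) @ F --> l.
  suff /cvg_ex[l] : cvg ((fun v : V => v k) @ F) by exists l.
  apply: cauchy_cvg; apply: cauchy_exP => e /Fc[x xF].
  exists (x k); rewrite /= /fmap /=; rewrite -ball_normE in xF.
  apply: filterS xF => y /= xy; rewrite -ball_normE /=.
  apply: le_lt_trans xy; exact: (seq_space_coord (x - y) k).
have [l lF] := choice coord_cvg.
have near_l (e : R) (x : V) : F (ball x e) ->
    forall N, s N (fun k => l k - x k) <= e.
  move=> Fx N; apply/ler_addgt0Pr => d d0.
  have N0 : 0 < N.+1%:R :> R by [].
  (* Finitely many coordinates can be controlled by a single [y] in the ball. The divisor is [N.+1]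
     to stay positive when [N] is 0; the [N] errors still add up to at most [d]. *)
  have [y [xy ly]] : exists y : V, `|x - y| < e /\
      forall k : 'I_N, `|l k - y k| <= d / N.+1%:R.
    apply: (@filter_ex _ F); apply: filterI.
      by apply: filterS Fx => y; rewrite -ball_normE.
    apply: filter_forall => k; have /cvgrPdist_le := lF k.
    by apply; exact: divr_gt0.
  apply: le_trans (_ : s N (fun k => (l k - y k) + (- 1) * (x - y) k) <= _).
    by apply: sec_solid => k _; rewrite mulN1r [(x - y) k]/(_ - _) opprB addrA subrK.
  apply: le_trans (secD _ _ _ _) _; rewrite secZ normrN1 mul1r addrC lerD//.
    by apply: le_trans (ltW xy); exact: seq_space_le_norm.
  apply: le_trans (sec_le_coords (d := d / N.+1%:R) _) _.
    by move=> k kN; exact: (ly (Ordinal kN)).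
  rewrite -[leLHS]mulr_natr -mulrA; apply: ler_piMr; first exact: ltW.
  by rewrite mulrC ler_pdivrMr// mul1r ler_nat leqnSn.
have lnt : l \in null_tails_pred s.
  apply/null_tailsP => e e0; have e2 : 0 < e / 2 by rewrite divr_gt0.
  have [x /near_l xl] := Fc _ e2.
  have [M xM] := seq_space_null_tails x e2.
  exists M => N; apply: le_trans (sec_tailB _ _ _ x) _.
  by rewrite (splitr e) lerD.
apply/cvg_ex; exists (SeqSpace lnt); apply/cvgrPdist_le => e e0.
have e2 : 0 < e / 2 by rewrite divr_gt0.
have [x Fx] := Fc _ e2; near=> y.
have -> : SeqSpace lnt - y = (SeqSpace lnt - x) + (x - y) by rewrite addrA subrK.
apply: le_trans (ler_normD _ _) _; rewrite (splitr e) lerD//.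
  by apply: seq_norm_le => N; exact: near_l.
apply: ltW; near: y; apply: filterS Fx => y; by rewrite -ball_normE.
Unshelve. all: by end_near. Qed.

HB.instance Definition _ := Uniform_isComplete.Build V seq_space_complete.

Lemma seq_delta_null_tails m : seq_delta R m \in null_tails_pred s.
Proof.
apply/null_tailsP => e e0; exists m.+1 => N; rewrite sec_eq0 ?ltW// => k _.
rewrite /seq_tail /seq_delta; case: ltnP => // mk.
by rewrite gtn_eqF.
Qed.

Definition unit_seq m : V := SeqSpace (seq_delta_null_tails m).

Lemma coord_unit_seq_series (v : V) n k :
  series (fun n => v n *: unit_seq n) n k = if (k < n)%N then v k else 0.
Proof.
elim: n => [|n IHn]; first by rewrite seriesEnat/= big_geq.
rewrite seriesSr; set u := series _ n.
have -> : (u + v n *: unit_seq n) k = u k + v n * (k == n)%:R by [].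
rewrite IHn ltnS [(k <= n)%N]leq_eqVlt.
have [->|kn] := eqVneq k n; first by rewrite ltnn add0r mulr1.
by rewrite mulr0 addr0.
Qed.

(** The remainder after [n] terms is the tail of [v] from [n], so convergence is exactly the
    vanishing of tails. *)
Lemma unit_seq_expansion (v : V) :
  series (fun n => v n *: unit_seq n) @ \oo --> v.
Proof.
apply/cvgrPdist_le => e e0.
have [M vM] := seq_space_null_tails v e0.
near=> n; apply: seq_norm_le => N.
apply: le_trans (vM N).
apply: le_trans (sec_seq_tail_anti s N v (_ : (M <= n)%N)).
  apply: sec_solid => k _; rewrite [X in `|X|](_ : _ = v k -
    (series (fun n => v n *: unit_seq n) n) k)//.
  by rewrite coord_unit_seq_series /seq_tail; case: ifP; rewrite ?subrr ?subr0.
by near: n; exists M.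
Unshelve. all: by end_near. Qed.

Lemma norm_unit_seq m : `|unit_seq m| <= 1.
Proof.
apply: seq_norm_le => N; apply: le_trans (sec_le_series _ _ _) _.
elim: N => [|N IHN]; first by rewrite seriesEnat/= big_geq.
(* Up to index [m] all earlier entries are 0, so the last term alone counts; past [m] the last term
   is 0. *)
rewrite seriesSr /=; have [Nm|mN] := ltnP N m.+1.
  rewrite (_ : series _ N = 0) ?add0r.
    by rewrite /seq_delta; case: eqP; rewrite /= ?normr1 ?normr0.
  rewrite seriesEord/= big1// => i _; rewrite /seq_delta ltn_eqF ?normr0//.
  by rewrite (leq_trans (ltn_ord i)).
by rewrite /seq_delta gtn_eqF// normr0 addr0.
Qed.

(** Section norms are dominated by the l_1 sums, so l_1 embeds in every one of these sequence
    spaces. *)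
Lemma null_tails_summable (a : nat -> R) :
  cvgn (series (fun n => `|a n|)) -> null_tails s a.
Proof.
move=> ca e e0.
have [M aM] := series_seq_tail_small (fun k => normr_ge0 (a k)) ca e0.
exists M => N; apply: le_trans (sec_le_series _ _ _) _.
rewrite (_ : (fun k => _) = seq_tail M (fun k => `|a k|))//.
by apply/funext => k; rewrite /seq_tail; case: ifP; rewrite ?normr0.
Qed.

End SeqSpaceComplete.

(** * The spaces l_p and c_0 *)

Section FiniteExponent.
Context {R : realType} (r : R) (r1 : 1 <= r).
Implicit Types a b : nat -> R.

Let r0 : 0 < r. Proof. exact: lt_le_trans r1. Qed.
Let rN0 : r != 0. Proof. by rewrite gt_eqF. Qed.

Definition power_sum n a : R := series (fun k => `|a k| `^ r) n.

Lemma power_sum_ge0 n a : 0 <= power_sum n a.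
Proof. by apply: sumr_ge0 => k _; exact: powR_ge0. Qed.

Lemma power_sumS n a : power_sum n.+1 a = power_sum n a + `|a n| `^ r.
Proof. exact: seriesSr. Qed.

Definition lp_sec n a : R := power_sum n a `^ r^-1.

Lemma lp_sec_ge0 n a : 0 <= lp_sec n a.
Proof. exact: powR_ge0. Qed.

Lemma powRVK x : 0 <= x -> (x `^ r) `^ r^-1 = x.
Proof. by move=> x0; rewrite -powRrM mulfV// powRr1. Qed.

Lemma powRKV x : 0 <= x -> (x `^ r^-1) `^ r = x.
Proof. by move=> x0; rewrite -powRrM mulVf// powRr1. Qed.

Lemma powR_le_root x y : 0 <= x -> 0 <= y -> x <= y `^ r -> x `^ r^-1 <= y.
Proof.
move=> x0 y0 xy; rewrite -[leRHS](powRVK y0).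
by apply: ge0_ler_powR; rewrite ?nnegrE ?powR_ge0// invr_ge0 ltW.
Qed.

Lemma root_le_powR x y : 0 <= x -> 0 <= y -> x `^ r^-1 <= y -> x <= y `^ r.
Proof.
move=> x0 y0 xy; rewrite -[leLHS](powRKV x0).
by apply: ge0_ler_powR; rewrite ?nnegrE ?powR_ge0// ltW.
Qed.

(* The convexity inequality for [powR ^~ r] at x / s and y / t, with weights
   s / (s + t) and t / (s + t). *)
Lemma powR_add_le (x y s t : R) : 0 <= x -> 0 <= y -> 0 < s -> 0 < t ->
  (x + y) `^ r <= (s + t) `^ r *
    (s / (s + t) * (x `^ r / s `^ r) + t / (s + t) * (y `^ r / t `^ r)).
Proof.
move=> x0 y0 s0 t0; have st0 : 0 < s + t by rewrite addr_gt0.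
have th0 : 0 <= s / (s + t) by rewrite divr_ge0 ?ltW.
have th1 : s / (s + t) <= 1 by rewrite ler_pdivrMr// mul1r lerDl ltW.
have thE : 1 - s / (s + t) = t / (s + t).
  by field; rewrite gt_eqF.
have xs : 0 <= x / s by rewrite divr_ge0// ltW.
have yt : 0 <= y / t by rewrite divr_ge0// ltW.
have := convex_powR r1 (Itv01 th0 th1) (x := x / s) (y := y / t).
rewrite !inE /= !in_itv/= !andbT => /(_ xs yt) cvx.
rewrite convRE [X in X `^ _ <= _]convRE /= /unstable.onem thE in cvx.
have -> : x + y = (s + t) * (s / (s + t) * (x / s) + t / (s + t) * (y / t)).
  by field; rewrite !gt_eqF.
rewrite powRM; [|exact: ltW|]; last first.
  by rewrite addr_ge0// mulr_ge0// divr_ge0// ltW.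
rewrite ler_pM2l ?powR_gt0//; apply: le_trans cvx _.
have divE u v : 0 <= u -> 0 < v -> (u / v) `^ r = u `^ r / v `^ r.
  move=> u0 v0; rewrite powRM ?invr_ge0 ?(ltW v0)//.
  by rewrite -(powR_inv1 (ltW v0)) -powRrM mulN1r powRN.
by rewrite !divE.
Qed.


(** Minkowski's inequality in terms of strictly positive bounds [s] and [t] instead of the norms,
    since these are divided by and a norm may be 0. *)
Lemma power_sumD n a b s t : 0 < s -> 0 < t ->
  power_sum n a <= s `^ r -> power_sum n b <= t `^ r ->
  power_sum n (fun k => a k + b k) <= (s + t) `^ r.
Proof.
move=> s0 t0 as_ bt; have st0 : 0 < s + t by rewrite addr_gt0.
have sr0 : 0 < s `^ r by rewrite powR_gt0.
have tr0 : 0 < t `^ r by rewrite powR_gt0.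
(* [w] is what the termwise convexity bounds sum to; it is at most 1, being a convex combination of
   two ratios at most 1. *)
pose w := s / (s + t) * (power_sum n a / s `^ r) +
          t / (s + t) * (power_sum n b / t `^ r).
apply: (@le_trans _ _ ((s + t) `^ r * w)).
  rewrite /w /power_sum !seriesEnat /= !mulr_suml !mulr_sumr -big_split/= mulr_sumr.
  apply: ler_sum => k _; apply: le_trans (powR_add_le _ _ s0 t0) => //.
  by apply: ge0_ler_powR; rewrite ?nnegrE ?addr_ge0 ?ler_normD// ltW.
rewrite ler_piMr ?powR_ge0//.
apply: (@le_trans _ _ (s / (s + t) * 1 + t / (s + t) * 1)); last first.
  by rewrite !mulr1 -mulrDl divff// gt_eqF.
have ws : 0 <= s / (s + t) by rewrite divr_ge0 ?ltW.
have wt : 0 <= t / (s + t) by rewrite divr_ge0 ?ltW.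
by rewrite lerD// ler_wpM2l// ler_pdivrMr ?mul1r.
Qed.

Lemma lp_secD n a b : lp_sec n (fun k => a k + b k) <= lp_sec n a + lp_sec n b.
Proof.
apply/ler_addgt0Pr => e e0; have e2 : 0 < e / 2 by rewrite divr_gt0.
(* Half of the slack goes to each norm to make both bounds strictly positive. *)
have -> : lp_sec n a + lp_sec n b + e = (lp_sec n a + e / 2) + (lp_sec n b + e / 2).
  by rewrite addrACA -splitr.
have pos c : 0 < lp_sec n c + e / 2 by rewrite ltr_wpDl ?lp_sec_ge0.
have dom c : power_sum n c <= (lp_sec n c + e / 2) `^ r.
  apply: root_le_powR; [exact: power_sum_ge0|exact: ltW|].
  by rewrite lerDl ltW.
apply: powR_le_root; first exact: power_sum_ge0.
  by rewrite ltW// addr_gt0.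
exact: power_sumD.
Qed.

Lemma lp_sec_solid n a b : (forall k, (k < n)%N -> `|a k| <= `|b k|) ->
  lp_sec n a <= lp_sec n b.
Proof.
move=> ab; apply: ge0_ler_powR; rewrite ?nnegrE ?power_sum_ge0 ?invr_ge0 ?(ltW r0)//.
rewrite /power_sum !seriesEord; apply: ler_sum => i _.
by apply: ge0_ler_powR; rewrite ?nnegrE ?(ltW r0)// ab.
Qed.

Lemma lp_secZ n c a : lp_sec n (fun k => c * a k) = `|c| * lp_sec n a.
Proof.
rewrite /lp_sec (_ : power_sum n _ = `|c| `^ r * power_sum n a).
  by rewrite powRM ?powR_ge0 ?power_sum_ge0// powRVK.
rewrite /power_sum !seriesEnat /= mulr_sumr; apply: eq_bigr => k _.
by rewrite normrM powRM.
Qed.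

Lemma lp_sec0 a : lp_sec 0 a = 0.
Proof. by rewrite /lp_sec /power_sum seriesEnat/= big_geq// powR0// invr_eq0. Qed.

Lemma lp_secS_ge n a : lp_sec n a <= lp_sec n.+1 a.
Proof.
apply: ge0_ler_powR; rewrite ?nnegrE ?power_sum_ge0 ?invr_ge0 ?(ltW r0)//.
by rewrite power_sumS lerDl powR_ge0.
Qed.

Lemma lp_sec_coord n a : `|a n| <= lp_sec n.+1 a.
Proof.
rewrite -[leLHS]powRVK//; apply: ge0_ler_powR;
  rewrite ?nnegrE ?power_sum_ge0 ?powR_ge0 ?invr_ge0 ?(ltW r0)//.
by rewrite power_sumS lerDr power_sum_ge0.
Qed.

(** Minkowski's inequality for the first [n] entries plus the single entry [a n]. *)
Lemma lp_secS_le n a : lp_sec n.+1 a <= lp_sec n a + `|a n|.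
Proof.
pose h k := if (k < n)%N then a k else 0.
pose g k := if k == n then a n else 0.
apply: (@le_trans _ _ (lp_sec n.+1 (fun k => h k + g k))).
  apply: lp_sec_solid => k; rewrite ltnS /h /g leq_eqVlt.
  have [->|_ /= ->] := eqVneq k n; first by rewrite ltnn add0r.
  by rewrite addr0.
apply: le_trans (lp_secD n.+1 h g) _; apply: lerD.
  rewrite /lp_sec power_sumS /h ltnn normr0 powR0// addr0.
  by apply: lp_sec_solid => k ->.
rewrite /lp_sec power_sumS /g eqxx /power_sum seriesEord /= big1 ?add0r ?powRVK//.
by move=> i _; rewrite ltn_eqF// normr0 powR0.
Qed.

Definition lp_section_norm : section_norm R := SectionNorm
  lp_sec0 lp_secS_ge lp_secS_le lp_sec_coord lp_sec_solid lp_secD lp_secZ.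

Lemma power_sum_nd a : nondecreasing_seq (power_sum ^~ a).
Proof. by apply: nondecreasing_series => k _ _; exact: powR_ge0. Qed.

(** Vanishing tails bound the monotone power sums by the norm to the power [r]; conversely the tail
    of a convergent series is eventually below [e] to the power [r]. *)
Lemma null_tails_in_lp a : null_tails lp_section_norm a <-> in_lp r%:E a.
Proof.
split=> [nta|ca].
  apply: nondecreasing_is_cvgn; first exact: power_sum_nd.
  exists (seq_norm lp_section_norm a `^ r) => _ [n _ <-].
  apply: root_le_powR; [exact: power_sum_ge0|exact: seq_norm_ge0|].
  exact: (le_seq_norm n nta).
move=> e e0; have er0 : 0 < e `^ r by rewrite powR_gt0.
have [M aM] := series_seq_tail_small (fun k => powR_ge0 `|a k| r) ca er0.
exists M => N; apply: powR_le_root; [exact: power_sum_ge0|exact: ltW|].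
apply: le_trans (aM N); rewrite /power_sum; apply: ler_sum => k _.
by rewrite /seq_tail; case: ifP => // _; rewrite normr0 powR0.
Qed.

Lemma seq_norm_lp a : in_lp r%:E a -> seq_norm lp_section_norm a = lp_norm r%:E a.
Proof.
move=> ca; have nta := (null_tails_in_lp a).2 ca; apply: le_anti; apply/andP; split.
  apply: seq_norm_le => N; apply: ge0_ler_powR;
    rewrite ?nnegrE ?power_sum_ge0 ?invr_ge0 ?(ltW r0)//.
    apply: limr_ge => //; near=> n; exact: power_sum_ge0.
  exact: (nondecreasing_cvgn_le (@power_sum_nd a) ca N).
apply: powR_le_root; [|exact: seq_norm_ge0|].
  by apply: limr_ge => //; near=> n; exact: power_sum_ge0.
apply: limr_le => //; near=> n.
apply: root_le_powR; [exact: power_sum_ge0|exact: seq_norm_ge0|].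
exact: (le_seq_norm n nta).
Unshelve. all: by end_near. Qed.

End FiniteExponent.

(** * The sup norm and c_0 *)

Section InfiniteExponent.
Context {R : realType}.
Implicit Types a b : nat -> R.

Definition max_sec n a : R := \big[Num.max/0]_(k < n) `|a k|.

Lemma max_sec_le n a C : 0 <= C -> (forall k, (k < n)%N -> `|a k| <= C) ->
  max_sec n a <= C.
Proof. by move=> C0 aC; apply: bigmax_le => // i _; exact: aC. Qed.

Lemma le_max_sec n a k : (k < n)%N -> `|a k| <= max_sec n a.
Proof. by move=> kn; exact: (le_bigmax _ (fun i : 'I_n => `|a i|) (Ordinal kn)). Qed.

Lemma max_sec_ge0 n a : 0 <= max_sec n a.
Proof. exact: bigmax_ge_id. Qed.

Lemma max_sec0 a : max_sec 0 a = 0.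
Proof. by rewrite /max_sec big_ord0. Qed.

Lemma max_secS_ge n a : max_sec n a <= max_sec n.+1 a.
Proof.
by apply: max_sec_le (max_sec_ge0 _ _) _ => k kn; exact: le_max_sec (leqW kn).
Qed.

Lemma max_secS_le n a : max_sec n.+1 a <= max_sec n a + `|a n|.
Proof.
apply: max_sec_le => [|k]; first by rewrite addr_ge0// max_sec_ge0.
rewrite ltnS leq_eqVlt => /predU1P[->|kn]; first by rewrite lerDr max_sec_ge0.
by apply: le_trans (le_max_sec _ kn) _; rewrite lerDl.
Qed.

Lemma max_sec_coord n a : `|a n| <= max_sec n.+1 a.
Proof. exact: le_max_sec. Qed.

Lemma max_sec_solid n a b : (forall k, (k < n)%N -> `|a k| <= `|b k|) ->
  max_sec n a <= max_sec n b.
Proof.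
move=> ab; apply: max_sec_le (max_sec_ge0 _ _) _ => k kn.
by apply: le_trans (ab k kn) _; exact: le_max_sec.
Qed.

Lemma max_secD n a b : max_sec n (fun k => a k + b k) <= max_sec n a + max_sec n b.
Proof.
apply: max_sec_le => [|k kn]; first by rewrite addr_ge0// max_sec_ge0.
by apply: le_trans (ler_normD _ _) _; rewrite lerD// le_max_sec.
Qed.

Lemma max_secZ n c a : max_sec n (fun k => c * a k) = `|c| * max_sec n a.
Proof.
have le_secZ d b : max_sec n (fun k => d * b k) <= `|d| * max_sec n b.
  apply: max_sec_le => [|k kn]; first by rewrite mulr_ge0// max_sec_ge0.
  by rewrite normrM ler_wpM2l// le_max_sec.
apply: le_anti; rewrite le_secZ/=; have [->|c0] := eqVneq c 0.
  by rewrite normr0 mul0r max_sec_ge0.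
rewrite -ler_pdivlMl ?normr_gt0// -normfV.
apply: le_trans (le_secZ c^-1 (fun k => c * a k)).
by apply: max_sec_solid => k _; rewrite mulKf.
Qed.

Definition max_section_norm : section_norm R := SectionNorm
  max_sec0 max_secS_ge max_secS_le max_sec_coord max_sec_solid max_secD max_secZ.

Lemma null_tails_c0 a : null_tails max_section_norm a <-> in_lp +oo%E a.
Proof.
split=> [nta|ca].
  apply/cvgr0Pnorm_le => e /nta[M aM]; near=> n.
  (* For [n] at least [M] the entry [a n] survives in the tail, and the section of length [n.+1] is
     the first to contain it. *)
  have := le_trans (le_max_sec (seq_tail M a) (ltnSn n)) (aM n.+1).
  rewrite /seq_tail ltnNge ifF//; apply/negbTE; rewrite negbK.
  by near: n; exists M.
move=> e e0; have /cvgr0Pnorm_le/(_ e e0)[M _ aM] := ca.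
exists M => N; apply: max_sec_le (ltW e0) _ => k _; rewrite /seq_tail.
by case: ltnP => [_|/aM//]; rewrite normr0 ltW.
Unshelve. all: by end_near. Qed.

Lemma seq_norm_c0 a : in_lp +oo%E a -> seq_norm max_section_norm a = lp_norm +oo%E a.
Proof.
move=> /null_tails_c0 nta; apply: le_anti; apply/andP; split.
  have ub : has_ubound (range (fun n => `|a n|)).
    exists (seq_norm max_section_norm a) => _ [n _ <-]; exact: coord_le_norm.
  apply: seq_norm_le => N; apply: max_sec_le => [|k _].
    by apply: le_trans (normr_ge0 (a 0%N)) _; apply: ub_le_sup => //; exists 0%N.
  by apply: ub_le_sup => //; exists k.
apply: ge_sup; first by exists `|a 0%N|, 0%N.
by move=> _ [n _ <-]; exact: coord_le_norm.
Qed.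

End InfiniteExponent.

(** From here on all exponents, finite or not, are handled at once through their section norm. *)
Lemma exists_section_norm (R : realType) (p : \bar R) : (1%:E <= p)%E ->
  exists s : section_norm R, forall a,
    (null_tails s a <-> in_lp p a) /\ (in_lp p a -> seq_norm s a = lp_norm p a).
Proof.
case: p => [r r1| _|//].
  exists (lp_section_norm r1) => a.
  by split; [exact: null_tails_in_lp|exact: seq_norm_lp].
exists max_section_norm => a.
by split; [exact: null_tails_c0|exact: seq_norm_c0].
Qed.

(** * Spaces of series of functions *)

Section FeatureSeries.
Context {R : realType} {T : ptopologicalType} (phi : nat -> T -> R).
Hypothesis phi_summable : forall x, cvgn (series (fun n => `|phi n x|)).
Implicit Types a b : nat -> R.

Definition synth a (x : T) : R := limn (series (fun n => a n * phi n x)).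

(** Bounded coefficients suffice because the features are absolutely summable at each point; this
    covers both the sequences in the space and the coefficients of functionals. *)
Lemma synth_cvg a C x : (forall n, `|a n| <= C) ->
  series (fun n => a n * phi n x) @ \oo --> synth a x.
Proof.
move=> aC; apply: normed_cvg.
apply: (@series_le_cvg _ _ (fun n => C * `|phi n x|)) => [n|n|n|] /=.
- exact: normr_ge0.
- by rewrite mulr_ge0// (le_trans (normr_ge0 (a 0%N))).
- by rewrite normrM ler_wpM2r.
- by apply: is_cvg_seriesZ.
Qed.

(** With [C] the norm of a sequence, this makes point evaluations continuous functionals. *)
Lemma synth_norm_le a C x : (forall n, `|a n| <= C) ->
  `|synth a x| <= C * limn (series (fun n => `|phi n x|)).
Proof.
move=> aC; have C0 : 0 <= C := le_trans (normr_ge0 _) (aC 0%N).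
have cv : cvgn (series (fun n => `|a n * phi n x|)).
  apply: (@series_le_cvg _ _ (fun n => C * `|phi n x|)) => [n|n|n|] /=.
  - exact: normr_ge0.
  - by rewrite mulr_ge0.
  - by rewrite normrM ler_wpM2r.
  - by apply: is_cvg_seriesZ.
apply: le_trans (lim_series_norm _) _; first exact: cv.
have -> : C * limn (series (fun n => `|phi n x|)) =
    limn (series (C *: (fun n => `|phi n x|))) by rewrite lim_seriesZ.
apply: lim_series_le; [exact: cv|exact: is_cvg_seriesZ|move=> n /=].
by rewrite normrM ler_wpM2r.
Qed.

Lemma measurable_synth a C : (forall n, `|a n| <= C) ->
  (forall n, measurable_fun [set: borelType T] (phi n : borelType T -> R)) ->
  measurable_fun [set: borelType T] (synth a : borelType T -> R).
Proof.
move=> aC mphi.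
apply: (@measurable_fun_cvg _ _ _ _
    (fun N (x : borelType T) => series (fun n => a n * phi n x) N)).
  move=> N; apply: measurable_sum => n.
  by apply: measurable_funM => //; exact: mphi.
by move=> x _; exact: synth_cvg.
Qed.

Lemma synth_lin (c : R) a b x (C D : R) :
  (forall n, `|a n| <= C) -> (forall n, `|b n| <= D) ->
  synth (fun n => c * a n + b n) x = c * synth a x + synth b x.
Proof.
move=> aC bD; apply: cvg_lim => //.
have -> : series (fun n => (c * a n + b n) * phi n x) =
    c *: series (fun n => a n * phi n x) + series (fun n => b n * phi n x).
  rewrite -seriesZ -seriesD; congr series; apply/funext => n.
  by rewrite mulrDl -mulrA.
apply: cvgD; last exact: synth_cvg bD.
by apply: cvgMr; exact: synth_cvg aC.
Qed.

Hypothesis phi_measurable : forall n,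
  measurable_fun [set: borelType T] (phi n : borelType T -> R).
Hypothesis phi_independent : forall a C, (forall n, `|a n| <= C) ->
  (forall x, series (fun n => a n * phi n x) @ \oo --> 0) -> forall n, a n = 0.

Lemma synth_eq0 a C : (forall n, `|a n| <= C) -> (forall x, synth a x = 0) ->
  forall n, a n = 0.
Proof.
move=> aC a0; apply: (phi_independent aC) => x; rewrite -(a0 x).
exact: synth_cvg aC.
Qed.

Lemma synth_inj a b C D : (forall n, `|a n| <= C) -> (forall n, `|b n| <= D) ->
  (forall x, synth a x = synth b x) -> a = b.
Proof.
move=> aC bD ab; apply/funext => n; apply/eqP; rewrite -subr_eq0; apply/eqP.
have -> : a n - b n = (- 1) * b n + a n by rewrite mulN1r addrC.
move: n; apply: (@synth_eq0 _ (`|- 1| * D + C)) => [n|x].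
  by apply: le_trans (ler_normD _ _) _; rewrite normrM lerD// ler_wpM2l.
by rewrite (synth_lin _ _ bD aC) ab mulN1r addNr.
Qed.

(** * The sequence space and its dual as spaces of functions *)

Variable s : section_norm R.
Local Notation V := (seq_space s).

(** This sequence will represent the kernel section at [x], and the function attached to a
    functional is its value on it. *)
Definition feature (x : T) : V :=
  SeqSpace (introT (null_tailsP s _) (null_tails_summable s (@phi_summable x))).

Lemma function_space_synth : function_space (fun v : V => synth v).
Proof.
split=> [x c u v|u v uv|v].
- exact: (synth_lin c x (seq_space_coord u) (seq_space_coord v)).
- apply: val_inj; apply: (synth_inj (seq_space_coord u) (seq_space_coord v)).
  by move=> x; rewrite uv.
- exact: measurable_synth (seq_space_coord v) phi_measurable.
Qed.

Lemma dual_unit_seq_bound (g : dual_space V) n : `|g (unit_seq s n)| <= dual_norm g.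
Proof.
by apply: dual_norm_ub; [exact: dual_space_continuous|exact: norm_unit_seq].
Qed.

(** Applying the continuous [g] to the expansion of [v] shows that its values on unit sequences
    determine it. *)
Lemma dual_seq_space_expansion (g : dual_space V) (v : V) :
  series (fun n => v n * g (unit_seq s n)) @ \oo --> g v.
Proof.
have [lg cg] := dual_space_continuous g.
have -> : series (fun n => v n * g (unit_seq s n)) =
    (g : V -> R) \o series (fun n => v n *: unit_seq s n).
  have [f fg] := scalar_is_linear lg.
  apply/funext => N; rewrite /= -fg /series/= linear_sum.
  by apply: eq_bigr => n _; rewrite linearZ.
by apply: continuous_cvg; [exact: cg|exact: unit_seq_expansion].
Qed.

Lemma dual_featureE (g : dual_space V) x :
  g (feature x) = synth (fun n => g (unit_seq s n)) x.
Proof.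
apply/esym/cvg_lim => //.
have := @dual_seq_space_expansion g (feature x).
by under eq_fun do rewrite mulrC.
Qed.

Lemma function_space_dual :
  function_space (fun (g : dual_space V) x => g (feature x)).
Proof.
split=> [x c f g //|f g fg|g].
  (* Both functions are series in the features with bounded coefficients, so independence identifies
     the coefficients, and these determine the functionals. *)
  have fgu : (fun n => f (unit_seq s n)) = (fun n => g (unit_seq s n)).
    apply: (synth_inj (dual_unit_seq_bound f) (dual_unit_seq_bound g)) => x.
    by rewrite -!dual_featureE; exact: (congr1 (@^~ x) fg).
  apply/val_inj/funext => v.
  rewrite -[LHS](cvg_lim (@Rhausdorff R) (@dual_seq_space_expansion f v)).
  rewrite -[RHS](cvg_lim (@Rhausdorff R) (@dual_seq_space_expansion g v)).
  congr (limn (series _)); apply/funext => n.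
  by rewrite (congr1 (@^~ n) fgu).
rewrite (_ : (fun x => _) = synth (fun n => g (unit_seq s n))).
  exact: measurable_synth (dual_unit_seq_bound g) phi_measurable.
by apply/funext => x; exact: dual_featureE.
Qed.

Lemma synth_continuous_dual x : (fun v : V => synth v x) \in @dual_pred R V.
Proof.
apply/dual_predP; have [/(_ x) lin _ _] := function_space_synth.
split=> //; apply/(continuous_dualP lin).
exists (limn (series (fun n => `|phi n x|))) => v.
by rewrite mulrC; exact: synth_norm_le (seq_space_coord v).
Qed.

(** In the dual, the section of [K] at [x] is evaluation at [x]; in the sequence space it is
    [feature x]. Both reproducing identities then hold by definition of the pairing and of the
    attached functions. *)
Lemma two_sided_RKBS_synth (K : T -> T -> R) :
  (forall x y, series (fun n => phi n x * phi n y) @ \oo --> K x y) ->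
  two_sided_RKBS (fun v : V => synth v) K.
Proof.
move=> KE; split; first exact: function_space_synth.
have featE x y : synth (feature x) y = K x y by apply: cvg_lim => //; exact: KE.
(* Symmetry is read off the expansion; it matches [featE] with the order of arguments in both
   reproducing properties. *)
have Ksym x y : K x y = K y x.
  rewrite -(cvg_lim (@Rhausdorff R) (@KE x y)).
  rewrite -(cvg_lim (@Rhausdorff R) (@KE y x)).
  by congr (limn (series _)); apply/funext => n; rewrite mulrC.
exists (dual_space V), (fun (g : dual_space V) x => g (feature x)).
exists (fun v (g : dual_space V) => g v); split.
- exact: function_space_dual.
- exact: dual_pairing_dual_space.
- move=> x; exists (DualSpace (synth_continuous_dual x)) => //.
  by apply/funext => y /=; rewrite featE.
- move=> y; exists (feature y) => //.
  by apply/funext => x; rewrite featE.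
Qed.

End FeatureSeries.

(** * Orthonormal series *)

(** Open intervals generate the Borel sets of the reals, and their preimages are open. *)
Lemma continuous_borel_measurable (R : realType) (T : ptopologicalType)
    (f : T -> R) :
  continuous f -> measurable_fun [set: borelType T] (f : borelType T -> R).
Proof.
move=> /continuousP cf; apply: (measurability _ (RGenOpens.measurableE R)).
move=> _ [_ [a [b ->] <-]]; rewrite setTI.
by apply: sub_sigma_algebra; exact/cf/interval_open.
Qed.

Section CompactMeasure.
Context {R : realType} {T : ptopologicalType}.
Variable mu : {measure set (borelType T) -> \bar R}.
Hypothesis T_compact : compact [set: T].
Hypothesis mu_finite : (mu [set: T] < +oo)%E.

(** Continuous functions on a compact space are bounded, and the measure is finite. *)
Lemma continuous_integrable (f : T -> R) : continuous f ->
  mu.-integrable [set: borelType T] (EFin \o (f : borelType T -> R)).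
Proof.
move=> cf; apply: measurable_bounded_integrable => //.
  exact: continuous_borel_measurable.
have /compact_bounded := continuous_compact (continuous_subspaceT cf) T_compact.
move=> [M [Mr fM]]; exists M; split => // x Mx y _ /=.
by apply: (fM x Mx); exists y.
Qed.

Lemma Rintegral_continuousD (f g : T -> R) : continuous f -> continuous g ->
  \int[mu]_x (f x + g x) = \int[mu]_x f x + \int[mu]_x g x.
Proof. by move=> cf cg; apply: RintegralD => //; exact: continuous_integrable. Qed.

Lemma Rintegral_continuousZ (c : R) (f : T -> R) : continuous f ->
  \int[mu]_x (c * f x) = c * \int[mu]_x f x.
Proof. by move=> cf; apply: RintegralZl => //; exact: continuous_integrable. Qed.

Variable e : nat -> T -> R.
Hypothesis e_continuous : forall n, continuous (e n).
Hypothesis e_orthonormal : forall m n, \int[mu]_x (e m x * e n x) = (m == n)%:R.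
Implicit Types c : nat -> R.

Definition partial_sum c n (x : T) : R := series (fun k => c k * e k x) n.

Lemma continuous_mul (f g : T -> R) : continuous f -> continuous g ->
  continuous (fun x => f x * g x).
Proof. by move=> cf cg x; apply: cvgM; [exact: cf|exact: cg]. Qed.

Lemma continuous_scale (a : R) (f : T -> R) : continuous f ->
  continuous (fun x => a * f x).
Proof. by move=> cf x; apply: cvgM; [exact: cvg_cst|exact: cf]. Qed.

Lemma continuous_add (f g : T -> R) : continuous f -> continuous g ->
  continuous (fun x => f x + g x).
Proof. by move=> cf cg x; apply: cvgD; [exact: cf|exact: cg]. Qed.

Lemma partial_sum0 c x : partial_sum c 0 x = 0.
Proof. by rewrite /partial_sum seriesEnat/= big_geq. Qed.

Lemma partial_sumS c n x : partial_sum c n.+1 x = partial_sum c n x + c n * e n x.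
Proof. exact: seriesSr. Qed.

Lemma continuous_partial_sum c n : continuous (partial_sum c n).
Proof.
elim: n => [|n IHn].
  rewrite (_ : partial_sum c 0 = cst 0); first exact: cst_continuous.
  by apply/funext => x; exact: partial_sum0.
rewrite (_ : partial_sum c n.+1 = fun x => partial_sum c n x + c n * e n x).
  by apply: continuous_add => //; exact: continuous_scale.
by apply/funext => x; exact: partial_sumS.
Qed.

Lemma Rintegral_partial_sum_orthogonal c n m : (n <= m)%N ->
  \int[mu]_x (partial_sum c n x * e m x) = 0.
Proof.
elim: n => [_|n IHn nm].
  under eq_Rintegral do rewrite partial_sum0 mul0r.
  by rewrite Rintegral_cst// mul0r.
under eq_Rintegral do rewrite partial_sumS mulrDl -mulrA.
rewrite Rintegral_continuousD; first last.
- by apply: continuous_scale; exact: continuous_mul.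
- by apply: continuous_mul => //; exact: continuous_partial_sum.
rewrite IHn ?(ltnW nm)// Rintegral_continuousZ; last exact: continuous_mul.
by rewrite e_orthonormal ltn_eqF// mulr0 addr0.
Qed.

Lemma Rintegral_partial_sum_sqr c n :
  \int[mu]_x (partial_sum c n x ^+ 2) = series (fun k => c k ^+ 2) n.
Proof.
elim: n => [|n IHn].
  under eq_Rintegral do rewrite partial_sum0 expr0n /=.
  by rewrite Rintegral_cst// mul0r seriesEnat/= big_geq.
(* Pythagoras: the cross term integrates to 0 by orthogonality and the last one to [c n ^+ 2]. *)
have E x : partial_sum c n.+1 x ^+ 2 = partial_sum c n x ^+ 2 +
    (2 * c n * (partial_sum c n x * e n x) + c n ^+ 2 * (e n x * e n x)).
  by rewrite partial_sumS; ring.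
under eq_Rintegral do rewrite E.
have cp := @continuous_partial_sum c n.
rewrite Rintegral_continuousD; first last.
- by apply: continuous_add; apply: continuous_scale; exact: continuous_mul.
- exact: continuous_mul.
rewrite Rintegral_continuousD; first last.
- by apply: continuous_scale; exact: continuous_mul.
- by apply: continuous_scale; exact: continuous_mul.
rewrite !Rintegral_continuousZ; first last.
- exact: continuous_mul.
- exact: continuous_mul.
rewrite IHn Rintegral_partial_sum_orthogonal// e_orthonormal eqxx.
by rewrite mulr0 mulr1 add0r seriesSr.
Qed.

Lemma partial_sum_tail c M n x : (M <= n)%N ->
  partial_sum (seq_tail M c) n x = partial_sum c n x - partial_sum c M x.
Proof.
move=> Mn; rewrite -(subnK Mn); elim: (n - M)%N => [|k IHk].
  rewrite add0n subrr /partial_sum seriesEord /= big1// => i _.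
  by rewrite /seq_tail ltn_ord mul0r.
by rewrite addSn !partial_sumS IHk /seq_tail ltnNge leq_addl/= addrAC.
Qed.

Lemma series_seq_tail_sqr_le c M n :
  cvgn (series (fun k => c k ^+ 2)) ->
  series (fun k => seq_tail M c k ^+ 2) n <=
    limn (series (fun k => c k ^+ 2)) - series (fun k => c k ^+ 2) M.
Proof.
rewrite (_ : (fun k => seq_tail M c k ^+ 2) = seq_tail M (fun k => c k ^+ 2)).
  by apply: series_seq_tail_le => k; exact: sqr_ge0.
by apply/funext => k; rewrite /seq_tail; case: ifP; rewrite ?expr0n.
Qed.

(* If the partial sums f_n tend to 0 then Fatou's lemma for (f_n - f_M)^2 as
   n grows gives \int f_M^2 <= \sum_(k >= M) c_k^2. *)
Lemma series_sqr_le_tail c M :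
  cvgn (series (fun k => c k ^+ 2)) ->
  (forall x, partial_sum c ^~ x @ \oo --> 0) ->
  series (fun k => c k ^+ 2) M <=
    limn (series (fun k => c k ^+ 2)) - series (fun k => c k ^+ 2) M.
Proof.
move=> cc c0; set B := leRHS.
pose f n (x : borelType T) := ((partial_sum (seq_tail M c) n x) ^+ 2)%:E.
have csq d n : continuous (fun x => partial_sum d n x ^+ 2).
  by apply: continuous_mul; exact: continuous_partial_sum.
have mf n : measurable_fun setT (f n).
  have := continuous_borel_measurable (csq (seq_tail M c) n).
  by move/measurable_EFinP; apply.
have f0 n x : setT x -> (0 <= f n x)%E by move=> _; rewrite lee_fin sqr_ge0.
(* The tail sum is the difference of the partial sums at [n] and [M]; the first tends to 0, and
   squaring removes the sign. *)
have fl x : limn_einf (f^~ x) = (partial_sum c M x ^+ 2)%:E.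
  suff /cvg_limn_einf_sup[] : f^~ x @ \oo --> (partial_sum c M x ^+ 2)%:E by [].
  apply: cvg_EFin; first by near=> n.
  have h : (fun n => partial_sum c n x - partial_sum c M x) @ \oo -->
      0 - partial_sum c M x by apply: cvgB; [exact: c0|exact: cvg_cst].
  rewrite -(sqrrN (partial_sum c M x)) -[- _]sub0r.
  apply: cvg_trans (cvgM h h); apply: near_eq_cvg.
  by near=> n; rewrite /= partial_sum_tail//; near: n; exists M.
have := fatou mu measurableT mf f0.
under eq_integral do rewrite fl.
have intE d n : (\int[mu]_x ((partial_sum d n x ^+ 2)%:E))%E =
    (series (fun k => d k ^+ 2) n)%:E.
  rewrite -Rintegral_partial_sum_sqr fineK//; apply: integrable_fin_num => //.
  exact: continuous_integrable.
rewrite intE -lee_fin => /le_trans; apply.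
rewrite limn_einf_lim; apply: lime_le; first exact: is_cvg_einfs.
(* The infimum over indices from [n] on is at most the integral at [n], which is a tail sum of
   squares. *)
near=> n; apply: le_trans (_ : (\int[mu]_x f n x <= _)%E).
  by apply: ereal_inf_lbound; exists n => /=.
by rewrite intE lee_fin; exact: series_seq_tail_sqr_le.
Unshelve. all: by end_near. Qed.

(** As [M] grows in [series_sqr_le_tail] the right-hand side tends to 0, so the full sum of squares
    is at most 0 and each term vanishes. *)
Lemma orthonormal_series_independent c :
  cvgn (series (fun k => c k ^+ 2)) ->
  (forall x, partial_sum c ^~ x @ \oo --> 0) -> forall n, c n = 0.
Proof.
move=> cc c0 n; set S := series _ in cc.
have Snd : nondecreasing_seq S by apply: nondecreasing_series => k _ _; exact: sqr_ge0.
have lim_le0 : limn S <= 0.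
  have tail0 : (fun k => limn S - S k) @ \oo --> limn S - limn S.
    by apply: cvgB; [exact: cvg_cst|exact: cc].
  rewrite -(subrr (limn S)); apply: (ler_cvg_to cc tail0).
  by near=> k; exact: series_sqr_le_tail.
have Sn1 : S n.+1 <= 0 := le_trans (nondecreasing_cvgn_le Snd cc n.+1) lim_le0.
apply/eqP; rewrite -sqrf_eq0 eq_le sqr_ge0 andbT.
apply: le_trans Sn1; rewrite /S seriesSr lerDr.
by apply: sumr_ge0 => k _; exact: sqr_ge0.
Unshelve. all: by end_near. Qed.

End CompactMeasure.

(** * Mercer features *)

Section MercerFeatures.
Context {R : realType} {T : ptopologicalType}.
Variable mu : {measure set (borelType T) -> \bar R}.
Hypothesis T_compact : compact [set: T].
Hypothesis mu_finite : (mu [set: T] < +oo)%E.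
Variables (K : T -> T -> R) (lambda : nat -> R) (e : nat -> T -> R).
Hypothesis K_continuous : continuous (fun z : T * T => K z.1 z.2).
Hypothesis eigensystem : mercer_system mu K lambda e.

Definition mercer_feature (n : nat) (x : T) : R := Num.sqrt (lambda n) * e n x.

Lemma kernel_expansion x y :
  series (fun n => lambda n * e n x * e n y) @ \oo --> K x y.
Proof.
have /pointwise_uniform_cvg/pointwise_cvgP/(_ (x, y)) /= := ms_expansion_unif eigensystem.
by apply: cvg_trans; apply: near_eq_cvg; near=> N.
Unshelve. all: by end_near. Qed.

Lemma kernel_feature_expansion x y :
  series (fun n => mercer_feature n x * mercer_feature n y) @ \oo --> K x y.
Proof.
rewrite (_ : (fun n => _) = fun n => lambda n * e n x * e n y).
  exact: kernel_expansion.
apply/funext => n; rewrite /mercer_feature mulrACA -expr2 sqr_sqrtr ?mulrA//.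
exact: ltW (ms_gt0 eigensystem n).
Qed.

Lemma continuous_diagonal : continuous (fun x => K x x).
Proof.
move=> x; apply: (@continuous_comp _ _ _ (fun x => (x, x)) (fun z => K z.1 z.2)).
  by apply: cvg_pair; exact: cvg_id.
exact: K_continuous.
Qed.

Lemma partial_trace_continuous N :
  continuous (fun x => series (fun n => lambda n * (e n x * e n x)) N).
Proof.
have ec := ms_continuous eigensystem.
elim: N => [|N IHN].
  rewrite (_ : (fun x => _) = cst 0); first exact: cst_continuous.
  by apply/funext => x; rewrite seriesEnat/= big_geq.
rewrite (_ : (fun x => _) = fun x =>
  series (fun n => lambda n * (e n x * e n x)) N + lambda N * (e N x * e N x)).
  by apply: continuous_add => //; apply: continuous_scale; exact: continuous_mul.
by apply/funext => x; exact: seriesSr.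
Qed.

Lemma Rintegral_partial_trace N :
  \int[mu]_x (series (fun n => lambda n * (e n x * e n x)) N) = series lambda N.
Proof.
have ec := ms_continuous eigensystem.
elim: N => [|N IHN].
  under eq_Rintegral do rewrite seriesEnat/= big_geq//.
  by rewrite Rintegral_cst// mul0r seriesEnat/= big_geq.
under eq_Rintegral do rewrite seriesSr.
rewrite Rintegral_continuousD//; first last.
- by apply: continuous_scale; exact: continuous_mul.
- exact: partial_trace_continuous.
rewrite IHN Rintegral_continuousZ//; last exact: continuous_mul.
by rewrite (ms_orthonormal eigensystem) eqxx mulr1 seriesSr.
Qed.

(** Partial sums of eigenvalues are integrals of the truncated diagonal expansion, whose terms are
    nonnegative; hence they are at most the integral of [K x x]. *)
Lemma eigenvalues_summable : cvgn (series lambda).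
Proof.
have l0 n : 0 <= lambda n := ltW (ms_gt0 eigensystem n).
apply: nondecreasing_is_cvgn; first by apply: nondecreasing_series => n _ _.
exists (\int[mu]_x K x x) => _ [N _ <-]; rewrite -Rintegral_partial_trace.
apply: le_Rintegral => //; [| |move=> x _].
- by apply: continuous_integrable => //; exact: partial_trace_continuous.
- by apply: continuous_integrable => //; exact: continuous_diagonal.
have cK : series (fun n => lambda n * (e n x * e n x)) @ \oo --> K x x.
  rewrite (_ : (fun n => _) = fun n => lambda n * e n x * e n x).
    exact: kernel_expansion.
  by apply/funext => n; rewrite mulrA.
rewrite -(cvg_lim (@Rhausdorff R) cK).
apply: nondecreasing_cvgn_le; last exact: cvgP cK.
by apply: nondecreasing_series => n _ _; rewrite mulr_ge0// -expr2 sqr_ge0.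
Qed.

(* The trace formula \sum lambda_n < +oo makes a_n sqrt(lambda_n) square
   summable for every bounded a. *)
Lemma mercer_feature_independent (a : nat -> R) C : (forall n, `|a n| <= C) ->
  (forall x, series (fun n => a n * mercer_feature n x) @ \oo --> 0) ->
  forall n, a n = 0.
Proof.
move=> aC a0 n; pose c k := a k * Num.sqrt (lambda k).
have l0 k : 0 <= lambda k := ltW (ms_gt0 eigensystem k).
suff : c n = 0.
  move/eqP; rewrite mulf_eq0 sqrtr_eq0 leNgt (ms_gt0 eigensystem) orbF.
  by move/eqP.
apply: (orthonormal_series_independent T_compact mu_finite
  (ms_continuous eigensystem) (ms_orthonormal eigensystem)).
(* Squares of the coefficients are dominated by [C ^+ 2 * lambda k], which is summable by the trace
   bound. *)
- apply: (@series_le_cvg _ _ (fun k => C ^+ 2 * lambda k)) => [k|k|k|].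
  + exact: sqr_ge0.
  + by rewrite mulr_ge0// sqr_ge0.
  + rewrite exprMn sqr_sqrtr// ler_wpM2r// -real_normK ?num_real//.
    by rewrite lerXn2r// ?nnegrE// (le_trans _ (aC k)).
  + by apply: is_cvg_seriesZ; exact: eigenvalues_summable.
- move=> x; rewrite /partial_sum.
  rewrite (_ : (fun k => c k * e k x) = fun k => a k * mercer_feature k x).
    exact: a0.
  by apply/funext => k; rewrite /mercer_feature mulrA.
Qed.

Hypothesis summable : forall x : T,
  cvgn (series (fun n => Num.sqrt (lambda n) * `|e n x|)).

Lemma mercer_feature_summable x : cvgn (series (fun n => `|mercer_feature n x|)).
Proof.
rewrite (_ : (fun n => _) = fun n => Num.sqrt (lambda n) * `|e n x|)//.
by apply/funext => n; rewrite normrM ger0_norm ?sqrtr_ge0.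
Qed.

Lemma measurable_mercer_feature n :
  measurable_fun [set: borelType T] (mercer_feature n : borelType T -> R).
Proof.
apply: continuous_borel_measurable; apply: continuous_scale.
exact: (ms_continuous eigensystem).
Qed.

(** Pointwise limits being unique, the expansions that define B_K^p are the functions [synth]. *)
Lemma expandsP (a : nat -> R) C (f : T -> R) : (forall n, `|a n| <= C) ->
  expands lambda e a f <-> f = synth mercer_feature a.
Proof.
move=> aC.
have E x : series (fun n => a n * Num.sqrt (lambda n) * e n x) =
    series (fun n => a n * mercer_feature n x).
  by congr series; apply/funext => n; rewrite /mercer_feature mulrA.
have cv x := synth_cvg mercer_feature_summable (x := x) aC.
split=> [af|-> x]; last by rewrite E; exact: cv.
apply/funext => x; have := af x; rewrite E => /(cvg_lim (@Rhausdorff R)) <-.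
by [].
Qed.

Lemma is_BK_synth (p : \bar R) (s : section_norm R) :
  (forall a, (null_tails s a <-> in_lp p a) /\
             (in_lp p a -> seq_norm s a = lp_norm p a)) ->
  is_BK lambda e p (fun v : seq_space s => synth mercer_feature v).
Proof.
move=> sp; split.
  apply/seteqP; split=> [_ [v _ <-]|f [a pa]].
    exists v; first exact/(sp v).1/seq_space_null_tails.
    exact/(expandsP _ (seq_space_coord v)).
  have nta := (sp a).1.2 pa.
  move=> /(expandsP _ (fun n => coord_le_norm n nta)) ->.
  by exists (SeqSpace (introT (null_tailsP s a) nta)).
move=> v a pa; have nta := (sp a).1.2 pa.
move=> /(expandsP _ (fun n => coord_le_norm n nta)) va.
rewrite seq_spaceE -(sp a).2//; congr (seq_norm s _).
(* The norm does not depend on the chosen expansion: bounded coefficients are unique. *)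
apply: (synth_inj mercer_feature_summable mercer_feature_independent
  (seq_space_coord v) (fun n => coord_le_norm n nta)) => x.
by rewrite va.
Qed.

Lemma mercer_two_sided_RKBS (p : \bar R) : (1%:E <= p)%E ->
  exists (V : completeNormedModType R) (ev : V -> T -> R),
    is_BK lambda e p ev /\ two_sided_RKBS ev K.
Proof.
move=> /exists_section_norm[s sp].
exists (seq_space s), (fun v : seq_space s => synth mercer_feature v).
split; first exact: is_BK_synth.
apply: two_sided_RKBS_synth.
- exact: mercer_feature_summable.
- exact: measurable_mercer_feature.
- exact: mercer_feature_independent.
- exact: kernel_feature_expansion.
Qed.

End MercerFeatures.

(** * The two claims, from the common construction for all exponents at least 1 *)

Lemma two_sided_right_sided (R : realType) (T : ptopologicalType)
    (V : completeNormedModType R) (ev : V -> T -> R) (K : T -> T -> R) :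
  two_sided_RKBS ev K -> right_sided_RKBS ev K.
Proof.
by move=> [fs [W [evW [pair [? ? ? _]]]]]; split=> //; exists W, evW, pair.
Qed.

Theorem theorem4p3 (R : realType) (T : ptopologicalType)
    (T_compact : compact [set: T]) (T_hausdorff : hausdorff_space T)
    (mu : {measure set (borelType T) -> \bar R})
    (mu_regular : regular_borel mu) (mu_support : msupport mu = [set: T])
    (K : T -> T -> R)
    (K_continuous : continuous (fun z : T * T => K z.1 z.2))
    (K_symmetric : forall x y, K x y = K y x)
    (K_posdef : positive_definite K)
    (lambda : nat -> R) (e : nat -> T -> R)
    (eigensystem : mercer_system mu K lambda e)
    (summable : forall x : T,
      cvgn (series (fun n => Num.sqrt (lambda n) * `|e n x|))) :
  (exists (V : completeNormedModType R) (ev : V -> T -> R),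
     is_BK lambda e 1%:E ev /\ right_sided_RKBS ev K) /\
  (forall p : \bar R, (1%:E < p)%E ->
   exists (V : completeNormedModType R) (ev : V -> T -> R),
     is_BK lambda e p ev /\ two_sided_RKBS ev K).
Proof.
(* Regularity makes compact sets of finite measure, and the whole space is compact. *)
have mu_finite : (mu [set: T] < +oo)%E by have [+ _ _] := mu_regular; apply.
have BK := mercer_two_sided_RKBS T_compact mu_finite K_continuous eigensystem summable.
split=> [|p /ltW p1]; last exact: BK.
have [V [ev [BKev RKev]]] := BK 1%:E (lexx _).
by exists V, ev; split=> //; exact: two_sided_right_sided.
Qed.
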